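(* Let $(M,g)$ be the Hayward black hole spacetime with parameters $m>0$, $b>0$: coordinates $(t,r,\theta,\phi)$ and $g=-\frac{B}{B_1}dt^2+\frac{B_1}{B}dr^2+r^2(d\theta^2+\sin^2\theta\, d\phi^2)$, where $B=2b^2m+r^2(r-2m)$, $B_1=2b^2m+r^3$, on the domain $r>0$, $0<\theta<\pi$, $2b^2m-2mr^2+r^3\neq 0$. Put $B_2=4b^2m-r^3$. Then $M$ realizes an almost $\eta$-Ricci-Yamabe soliton with the non-Killing soliton vector field $\xi=\frac{\partial}{\partial r}$ and the $1$-form $\eta=dr$ (components $(0,1,0,0)$); namely $$\frac12\pounds_\xi g+\sigma_1S+\left(\lambda-\frac12\sigma_4\kappa\right)g-\sigma_3\,\eta\otimes\eta=0,$$ where $\sigma_4=2$, $\lambda=\sigma_2+\kappa$, and $$\sigma_1=\frac{B_1^2(4b^4m^2+4b^2mr^3-3mr^5+r^6)}{36b^2m^2r^4B},\quad \sigma_2=\frac{4b^4m^2-2b^2mr^3+3mr^5-2r^6}{3r^4B},\quad \sigma_3=\frac{2mrB_2}{B^2}.$$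
   Context: $\pounds_\xi$ denotes the Lie derivative. An almost $\eta$-Ricci-Yamabe soliton is a manifold with a vector field $\xi$, a non-zero $1$-form $\eta$ and smooth functions $\alpha_1,\alpha_2,\mu,\lambda'$ with $\frac12\pounds_\xi g+\alpha_1S+(\mu-\frac12\alpha_2\kappa)g+\lambda'\,\eta\otimes\eta=0$. Sign of curvature: $R_{pq\mu\nu}=g_{p\alpha}(\partial_\mu\Gamma^\alpha_{q\nu}-\partial_\nu\Gamma^\alpha_{q\mu}+\Gamma^\beta_{q\nu}\Gamma^\alpha_{\beta\mu}-\Gamma^\beta_{q\mu}\Gamma^\alpha_{\beta\nu})$; Ricci tensor $S_{q\mu}=g^{p\nu}R_{pq\mu\nu}$; scalar curvature $\kappa=g^{q\mu}S_{q\mu}$. With this convention, for the present metric, $S_{33}=-\frac{12b^2m^2r^2}{B_1^2}$ and $\kappa=\frac{24b^2m^2(r^3-4b^2m)}{B_1^3}$ (so $S$ is the negative of the Ricci tensor in the convention where round spheres have positive Ricci curvature). *)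

(* Defs.v *)
From HB Require Import structures.
From mathcomp Require Import all_boot all_order all_algebra.
From mathcomp Require Import all_classical all_reals all_analysis.

Set Implicit Arguments.
Unset Strict Implicit.
Unset Printing Implicit Defensive.

Import Order.TTheory GRing.Theory Num.Theory.
Import numFieldNormedType.Exports.

Local Open Scope classical_set_scope.
Local Open Scope ring_scope.

(* Tensor calculus in one coordinate chart U of R^n.  A point is the row of
   its coordinates; a (0,2)-tensor field is given by its matrix of components,
   a vector field or a 1-form by its row of components. *)
Section Chart.
Context {R : realType} {n : nat}.
Local Notation point := 'rV[R]_n.
Implicit Types (U : set point) (f : point -> R) (g : point -> 'M[R]_n)
  (xi eta : point -> 'rV[R]_n) (x : point).

Definition partial (i : 'I_n) f x : R := 'D_(delta_mx 0 i) f x.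

Fixpoint Ck (k : nat) U f : Prop :=
  (forall x, U x -> {for x, continuous f}) /\
  if k is k'.+1 then
    forall i : 'I_n, (forall x, U x -> derivable f x (delta_mx 0 i)) /\
                     Ck k' U (partial i f)
  else True.

Definition smooth U f : Prop := forall k, Ck k U f.

Definition smooth_row U xi : Prop := forall i, smooth U (fun x => xi x 0 i).

Record pseudo_riemannian U g : Prop := {
  metric_domain_open : open U;
  metric_smooth : forall i j, smooth U (fun x => g x i j);
  metric_symmetric : forall x, U x -> (g x)^T = g x;
  metric_nondegenerate : forall x, U x -> g x \in unitmx }.

Definition metric_inv g x : 'M[R]_n := invmx (g x).

(* christoffel g a b c = \Gamma^a_{bc} *)
Definition christoffel g (a b c : 'I_n) x : R :=
  2^-1 * \sum_d metric_inv g x a d *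
    (partial b (fun y => g y d c) x + partial c (fun y => g y d b) x
     - partial d (fun y => g y b c) x).

(* riemann g p q u v = R_{pquv}, all indices down *)
Definition riemann g (p q u v : 'I_n) x : R :=
  \sum_a g x p a *
    (partial u (christoffel g a q v) x - partial v (christoffel g a q u) x
     + \sum_b christoffel g b q v x * christoffel g a b u x
     - \sum_b christoffel g b q u x * christoffel g a b v x).

(* The contraction is over the first and last indices of R_{pquv}, so this is
   the negative of the Ricci tensor that is positive on round spheres. *)
Definition ricci g x : 'M[R]_n :=
  \matrix_(q, u) \sum_p \sum_v metric_inv g x p v * riemann g p q u v x.

Definition scalar_curvature g x : R :=
  \sum_q \sum_u metric_inv g x q u * ricci g x q u.

Definition lie_derivative xi g x : 'M[R]_n :=
  \matrix_(i, j) \sum_k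
    (xi x 0 k * partial k (fun y => g y i j) x
     + g x k j * partial i (fun y => xi y 0 k) x
     + g x i k * partial j (fun y => xi y 0 k) x).

Definition killing U g xi : Prop := forall x, U x -> lie_derivative xi g x = 0.

(* \eta \otimes \eta *)
Definition tensor_square eta x : 'M[R]_n := (eta x)^T *m eta x.

Record almost_eta_ricci_yamabe_soliton U g xi eta
    (alpha1 alpha2 mu lambda' : point -> R) : Prop := {
  soliton_metric : pseudo_riemannian U g;
  soliton_field_smooth : smooth_row U xi;
  soliton_form_smooth : smooth_row U eta;
  soliton_form_neq0 : exists2 x, U x & eta x != 0;
  soliton_alpha1_smooth : smooth U alpha1;
  soliton_alpha2_smooth : smooth U alpha2;
  soliton_mu_smooth : smooth U mu;
  soliton_lambda_smooth : smooth U lambda';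
  soliton_eq : forall x, U x ->
    2^-1 *: lie_derivative xi g x + alpha1 x *: ricci g x
    + (mu x - 2^-1 * alpha2 x * scalar_curvature g x) *: g x
    + lambda' x *: tensor_square eta x = 0 }.

End Chart.

(* The coordinates (t, r, \theta, \phi) of x are x 0 0, x 0 1, x 0 2, x 0 3. *)
Section Hayward.
Context {R : realType}.
Variables m b : R.
Implicit Types (r : R) (x : 'rV[R]_4).

Definition hayB r : R := 2 * b ^+ 2 * m + r ^+ 2 * (r - 2 * m).
Definition hayB1 r : R := 2 * b ^+ 2 * m + r ^+ 3.
Definition hayB2 r : R := 4 * b ^+ 2 * m - r ^+ 3.

Definition hayward_domain : set 'rV[R]_4 :=
  [set x | [/\ 0 < x 0 1, 0 < x 0 2, x 0 2 < pi &
      2 * b ^+ 2 * m - 2 * m * x 0 1 ^+ 2 + x 0 1 ^+ 3 != 0]].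

Definition hayward_metric x : 'M[R]_4 :=
  let r := x 0 1 in let theta := x 0 2 in
  diag_mx (\row_i [:: - (hayB r / hayB1 r); hayB1 r / hayB r;
                      r ^+ 2; r ^+ 2 * sin theta ^+ 2]`_i).

Definition hayward_kappa : 'rV[R]_4 -> R := scalar_curvature hayward_metric.

Definition d_dr x : 'rV[R]_4 := delta_mx 0 1.
Definition dr x : 'rV[R]_4 := delta_mx 0 1.

Definition sigma1 x : R :=
  let r := x 0 1 in
  hayB1 r ^+ 2 * (4 * b ^+ 4 * m ^+ 2 + 4 * b ^+ 2 * m * r ^+ 3
                  - 3 * m * r ^+ 5 + r ^+ 6)
  / (36 * b ^+ 2 * m ^+ 2 * r ^+ 4 * hayB r).

Definition sigma2 x : R :=
  let r := x 0 1 in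
  (4 * b ^+ 4 * m ^+ 2 - 2 * b ^+ 2 * m * r ^+ 3 + 3 * m * r ^+ 5
   - 2 * r ^+ 6) / (3 * r ^+ 4 * hayB r).

Definition sigma3 x : R :=
  let r := x 0 1 in 2 * m * r * hayB2 r / hayB r ^+ 2.

Definition sigma4 x : R := 2.

Definition soliton_lambda x : R := sigma2 x + hayward_kappa x.

End Hayward.

(* Main.v *)
(* With f = B / B_1 the Hayward metric is the static spherically symmetric metric
   - f dt^2 + f^-1 dr^2 + r^2 (dtheta^2 + sin^2 theta dphi^2), all of whose
   Christoffel symbols are products F(r) G(theta).  Its Ricci tensor, in the sign
   convention of [ricci], is diagonal with entries
   - f a, a / f, c, c sin^2 theta, where a = f''/2 + f'/r and c = f + r f' - 1.
   Since lambda - sigma_4 kappa / 2 = sigma_2, the soliton equation reduces to one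
   identity of rational functions of r per diagonal entry.  The smoothness of
   lambda follows from the closed form of kappa, whose denominator B_1^3 is
   positive for r > 0. *)
Require Import Defs.
From HB Require Import structures.
From mathcomp Require Import all_boot all_order all_algebra.
From mathcomp Require Import all_classical all_reals all_analysis.
From mathcomp Require Import ring lra.

Import Order.TTheory GRing.Theory Num.Theory.
Import numFieldNormedType.Exports.

Set Implicit Arguments.
Unset Strict Implicit.
Unset Printing Implicit Defensive.

Local Open Scope classical_set_scope.
Local Open Scope ring_scope.

(** * Smooth functions on an open set of a chart *)

Section SmoothFunctions.
Context {R : realType} {n : nat} {U : set 'rV[R]_n} (openU : open U).
Implicit Types (f g : 'rV[R]_n -> R) (x : 'rV[R]_n) (k : nat) (i j : 'I_n).

Lemma eq_on_near f g x : (forall y, U y -> f y = g y) -> U x ->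
  {near x, f =1 g}.
Proof.
move=> fg Ux; have : nbhs x U by apply: open_nbhs_nbhs; split.
by apply: filterS => y /fg.
Qed.

Lemma eq_on_partial f g i x : (forall y, U y -> f y = g y) -> U x ->
  partial i f x = partial i g x.
Proof. by move=> fg Ux; apply: near_eq_derive; apply: eq_on_near. Qed.

(** Continuity and directional derivatives are local and [U] is open. Closed forms that are valid
    only on [U] may thus replace the functions they describe. *)
Lemma eq_on_Ck k f g : (forall x, U x -> f x = g x) -> Ck k U f -> Ck k U g.
Proof.
have cfg (h1 h2 : 'rV[R]_n -> R) x : (forall y, U y -> h1 y = h2 y) -> U x ->
    {for x, continuous h1} -> {for x, continuous h2}.
  move=> h12 Ux ch; rewrite /prop_for /continuous_at -(h12 _ Ux).
  apply: cvg_trans ch; apply: (@near_eq_cvg _ _ (nbhs x)).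
  exact: (eq_on_near h12 Ux).
elim: k f g => [|k IH] f g fg /= [cf df]; split => //.
- by move=> x Ux; apply: cfg (cf _ Ux).
- by move=> x Ux; apply: cfg (cf _ Ux).
- move=> i; have [dfi Cfi] := df i; split=> [x Ux|].
    by apply: near_eq_derivable (dfi _ Ux); apply: eq_on_near.
  by apply: IH Cfi => x Ux; apply: eq_on_partial.
Qed.

Lemma eq_on_smooth f g : (forall x, U x -> f x = g x) ->
  smooth U f -> smooth U g.
Proof. by move=> fg sf k; apply: eq_on_Ck (sf k). Qed.

(** * Algebraic closure properties of C^k functions *)

Lemma CkW k f : Ck k.+1 U f -> Ck k U f.
Proof.
elim: k f => [|k IH] f [cf df]; split=> // i.
by have [? ?] := df i; split=> //; apply: IH.
Qed.

Lemma Ck_cst k (c : R) : Ck k U (fun=> c).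
Proof.
elim: k c => [|k IH] c; split=> //; try by move=> x Ux; apply: cst_continuous.
move=> i; split=> [x Ux|]; first exact: derivable_cst.
by apply: eq_on_Ck (IH 0) => x Ux; rewrite /partial derive_cst.
Qed.

Lemma CkD k f g : Ck k U f -> Ck k U g -> Ck k U (fun x => f x + g x).
Proof.
elim: k f g => [|k IH] f g [cf df] [cg dg]; split=> //;
  try by move=> x Ux; exact: continuousD (cf _ Ux) (cg _ Ux).
move=> i; have [[dfi Cfi] [dgi Cgi]] := (df i, dg i); split=> [x Ux|].
    by apply: derivableD; [apply: dfi|apply: dgi].
  apply: eq_on_Ck (IH _ _ Cfi Cgi) => x Ux.
  by rewrite /partial deriveD; [|apply: dfi|apply: dgi].
Qed.

(** The Leibniz rule multiplies the partials by [f] and [g] themselves, so the induction also needs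
    these one order lower, which is [CkW]. *)
Lemma CkM k f g : Ck k U f -> Ck k U g -> Ck k U (fun x => f x * g x).
Proof.
elim: k f g => [|k IH] f g Cf Cg; have [[cf df] [cg dg]] := (Cf, Cg);
  split=> //; try by move=> x Ux; exact: continuousM (cf _ Ux) (cg _ Ux).
move=> i; have [[dfi Cfi] [dgi Cgi]] := (df i, dg i); split=> [x Ux|].
    by apply: derivableM; [apply: dfi|apply: dgi].
  apply: eq_on_Ck (CkD (IH _ _ (CkW Cf) Cgi) (IH _ _ (CkW Cg) Cfi)) => x Ux.
  by rewrite /partial deriveM; [|apply: dfi|apply: dgi].
Qed.

(** The partials of 1/f are -(1/f)^2 times those of [f], so the induction hypothesis is applied to
    1/f itself, one order lower. *)
Lemma CkV k f : (forall x, U x -> f x != 0) ->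
  Ck k U f -> Ck k U (fun x => (f x)^-1).
Proof.
move=> f0; elim: k => [|k IH] Cf; have [cf df] := Cf;
  split=> //; try by move=> x Ux; exact: continuousV (f0 _ Ux) (cf _ Ux).
move=> i; have [dfi Cfi] := df i; split=> [x Ux|].
    by apply: derivableV; [apply: f0|apply: dfi].
  have CV := IH (CkW Cf).
  apply: eq_on_Ck (CkM (CkM (Ck_cst k (-1)) (CkM CV CV)) Cfi) => x Ux.
  rewrite /partial deriveV; [|exact: f0|exact: dfi].
  by rewrite -[RHS]/(_ * _) mulN1r -exprVn expr2.
Qed.

Lemma smooth_cst (c : R) : smooth U (fun=> c).
Proof. by move=> k; apply: Ck_cst. Qed.

Lemma smoothD f g : smooth U f -> smooth U g -> smooth U (fun x => f x + g x).
Proof. by move=> sf sg k; apply: CkD. Qed.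

Lemma smoothM f g : smooth U f -> smooth U g -> smooth U (fun x => f x * g x).
Proof. by move=> sf sg k; apply: CkM. Qed.

Lemma smoothN f : smooth U f -> smooth U (fun x => - f x).
Proof.
move=> sf; apply: eq_on_smooth (smoothM (smooth_cst (-1)) sf) => x _.
by rewrite mulN1r.
Qed.

Lemma smoothX f k : smooth U f -> smooth U (fun x => f x ^+ k).
Proof.
move=> sf; elim: k => [|k IH]; first exact: smooth_cst.
by apply: eq_on_smooth (smoothM sf IH) => x _; rewrite exprS.
Qed.

Lemma smoothV f : (forall x, U x -> f x != 0) ->
  smooth U f -> smooth U (fun x => (f x)^-1).
Proof. by move=> f0 sf k; apply: CkV. Qed.

(** Moving along the i-th basis vector changes only coordinate i: the difference quotient is
    identically 0 if i differs from j, and otherwise is the one-variable quotient of [F]. *)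
Lemma is_derive_coord (F : R -> R) j i x (dF : R) :
  is_derive (x 0 j) 1 F dF ->
  is_derive x (delta_mx 0 i) (fun y => F (y 0 j)) ((i == j)%:R * dF).
Proof.
move=> dFx; have [ij|ij] := eqVneq i j; last first.
  rewrite mul0r.
  have E (h : R) : (h *: (delta_mx 0 i : 'rV[R]_n) + x) 0 j = x 0 j.
    by rewrite !mxE eqxx (eq_sym j) (negbTE ij) mulr0 add0r.
  have c0 : (fun h : R => h^-1 *: (((fun y : 'rV[R]_n => F (y 0 j)) \o shift x)
      (h *: delta_mx 0 i) - F (x 0 j))) = fun=> 0.
    by apply/funext => h; rewrite /= E subrr scaler0.
  by split; rewrite /derivable /derive c0; [exact: is_cvg_cst|exact: lim_cst].
rewrite mul1r; case: dFx => dFx <-; subst j.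
have E : (fun h : R => h^-1 *: (((fun y : 'rV[R]_n => F (y 0 i)) \o shift x)
      (h *: delta_mx 0 i) - F (x 0 i))) =
    fun h : R => h^-1 *: ((F \o shift (x 0 i)) (h *: (1 : R)) - F (x 0 i)).
  by apply/funext => h; rewrite /= !mxE !eqxx.
by split; rewrite /derivable /derive E.
Qed.

Lemma Ck_coord k j : Ck k U (fun x => x 0 j).
Proof.
have d (i : 'I_n) x := is_derive_coord (F := id) i (is_derive_id (x 0 j) 1).
case: k => [|k]; split=> //;
  try by move=> x Ux; exact: coord_continuous.
move=> i; split=> [x Ux|]; first by case: (d i x).
apply: eq_on_Ck (Ck_cst k (i == j)%:R) => x Ux.
by rewrite /partial; case: (d i x) => _ ->; rewrite mulr1.
Qed.

Lemma smooth_coord j : smooth U (fun x => x 0 j).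
Proof. by move=> k; apply: Ck_coord. Qed.

Lemma smooth_sin_coord j : smooth U (fun x => sin (x 0 j)).
Proof.
(* Sine and cosine differentiate into each other up to sign, so both are treated in one
   induction. *)
suff H k : Ck k U (fun x => sin (x 0 j)) /\ Ck k U (fun x => cos (x 0 j)).
  by move=> k; case: (H k).
have cs x : {for x, continuous (fun x : 'rV[R]_n => sin (x 0 j))}.
  by apply: continuous_comp; [exact: coord_continuous|exact: continuous_sin].
have cc x : {for x, continuous (fun x : 'rV[R]_n => cos (x 0 j))}.
  by apply: continuous_comp; [exact: coord_continuous|exact: continuous_cos].
have ds (i : 'I_n) x := is_derive_coord i (is_derive_sin (x 0 j)).
have dc (i : 'I_n) x := is_derive_coord i (is_derive_cos (x 0 j)).
elim: k => [|k [IHs IHc]]; first by [].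
split; split=> // i; split=> [x Ux|].
- by case: (ds i x).
- apply: eq_on_Ck (CkM (Ck_cst k (i == j)%:R) IHc) => x Ux.
  by rewrite /partial; case: (ds i x) => _ ->.
- by case: (dc i x).
- apply: eq_on_Ck (CkM (Ck_cst k (- (i == j)%:R)) IHs) => x Ux.
  by rewrite /partial; case: (dc i x) => _ ->; rewrite mulrN mulNr.
Qed.

End SmoothFunctions.

(** * Diagonal metrics *)

Section Curvature.
Context {R : realType} {n : nat}.
Implicit Types (g : 'rV[R]_n -> 'M[R]_n) (x : 'rV[R]_n) (d : 'rV[R]_n).

(** Contracting g^{pv} with g_{pa} gives the Kronecker delta, which undoes the lowering of the first
    index in [riemann]. Ricci becomes a trace of the mixed curvature tensor. *)
Lemma ricciE g x q u : g x \in unitmx -> (g x)^T = g x ->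
  ricci g x q u = \sum_p
    (partial u (christoffel g p q p) x - partial p (christoffel g p q u) x
     + \sum_b christoffel g b q p x * christoffel g p b u x
     - \sum_b christoffel g b q u x * christoffel g p b p x).
Proof.
move=> gU gT; rewrite mxE exchange_big /=; apply: eq_bigr => v _.
have contract a : \sum_p metric_inv g x p v * g x p a = (v == a)%:R.
  transitivity ((invmx (g x) *m g x) v a); last by rewrite mulVmx // mxE.
  (* The inverse of a symmetric matrix is symmetric, so the contraction is an entry of g^{-1} g. *)
  rewrite mxE; apply: eq_bigr => p _; rewrite /metric_inv.
  by congr (_ * _); rewrite -[in LHS]gT -trmx_inv mxE.
under eq_bigr => p _ do rewrite /riemann mulr_sumr.
rewrite exchange_big /= (bigD1 v) //= [X in _ + X]big1 ?addr0 => [|a av];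
  under eq_bigr => p _ do rewrite mulrA;
  rewrite -mulr_suml contract.
  by rewrite eqxx mul1r.
by rewrite eq_sym (negbTE av) mul0r.
Qed.

Lemma diag_mx_mulV d : (forall i, d 0 i != 0) ->
  diag_mx (\row_i (d 0 i)^-1) *m diag_mx d = 1%:M.
Proof.
move=> d0; rewrite mulmx_diag; apply/matrixP => i j; rewrite !mxE.
by have [->|//] := eqVneq i j; rewrite mulVf.
Qed.

Lemma diag_mx_unit d : (forall i, d 0 i != 0) -> diag_mx d \in unitmx.
Proof. by move=> /diag_mx_mulV /mulmx1_unit[]. Qed.

Lemma invmx_diag d : (forall i, d 0 i != 0) ->
  invmx (diag_mx d) = diag_mx (\row_i (d 0 i)^-1).
Proof.
move=> d0; rewrite -[LHS]mul1mx -(diag_mx_mulV d0) mulmxK //.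
exact: diag_mx_unit.
Qed.

Lemma partial_diag_mx (G : 'I_n -> 'rV[R]_n -> R) i j k x :
  partial k (fun y => diag_mx (\row_a G a y) i j) x =
    (i == j)%:R * partial k (G i) x.
Proof.
rewrite (_ : (fun y => _) = fun y => G i y *+ (i == j)); last first.
  by apply/funext => y; rewrite !mxE.
case: eqP => _; first by rewrite mul1r.
by rewrite mul0r /partial derive_cst.
Qed.

(** The inverse metric is diagonal too, so only the term d = a of the sum survives. *)
Lemma christoffel_diag_mx (G : 'I_n -> 'rV[R]_n -> R) a b c x :
  (forall i, G i x != 0) ->
  christoffel (fun y => diag_mx (\row_i G i y)) a b c x =
    (2 * G a x)^-1 * ((a == c)%:R * partial b (G a) x
      + (a == b)%:R * partial c (G a) x - (b == c)%:R * partial a (G b) x).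
Proof.
move=> G0; rewrite /christoffel /metric_inv invmx_diag => [|i]; last first.
  by rewrite mxE.
rewrite (bigD1 a) //= big1 ?addr0 => [|e ea]; last first.
  by rewrite mxE eq_sym (negbTE ea) mul0r.
by rewrite !partial_diag_mx !mxE eqxx mulr1n invfM mulrA.
Qed.

(** A coordinate field has constant components, so the terms that differentiate it vanish. *)
Lemma lie_derivative_coord g (k : 'I_n) x :
  lie_derivative (fun=> delta_mx 0 k) g x =
    \matrix_(i, j) partial k (fun y => g y i j) x.
Proof.
apply/matrixP => i j; rewrite !mxE (bigD1 k) //= big1 ?addr0 => [|l lk];
  rewrite /partial !derive_cst !mxE !mulr0 !addr0.
  by rewrite !eqxx mul1r.
by rewrite (negbTE lk) andbF mul0r.
Qed.

End Curvature.

(** * Static spherically symmetric metrics *)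

Section StaticSphericallySymmetric.
Context {R : realType} (f f1 f2 : R -> R).
Implicit Types (x : 'rV[R]_4) (r th : R).

(* Every metric coefficient and Christoffel symbol below is a product F(r) G(theta)
   and is encoded by the pair (F, G); its derivative pair is (F', G'). *)
Definition sep (F G : R -> R) x : R := F (x 0 1) * G (x 0 2).

Lemma partial_sep F G dF dG i x :
  is_derive (x 0 1) 1 F dF -> is_derive (x 0 2) 1 G dG ->
  partial i (sep F G) x =
    (i == 1)%:R * dF * G (x 0 2) + (i == 2)%:R * F (x 0 1) * dG.
Proof.
move=> dFx dGx.
have [? e] := is_deriveM (is_derive_coord i dFx) (is_derive_coord i dGx).
rewrite /partial (_ : sep F G = (fun y => F (y 0 1)) * (fun y => G (y 0 2))) //.
by rewrite e -![_ *: _]/(_ * _); ring.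
Qed.

(** Indices are natural numbers to allow matching on numerals; the catch-all branch stands for
    phi. *)
Definition static_coef (i : nat) : (R -> R) * (R -> R) :=
  match i with
  | 0 => (fun r => - f r, fun=> 1)
  | 1 => (fun r => (f r)^-1, fun=> 1)
  | 2 => (fun r => r ^+ 2, fun=> 1)
  | _ => (fun r => r ^+ 2, fun th => sin th ^+ 2)
  end.

Definition static_dcoef (i : nat) : (R -> R) * (R -> R) :=
  match i with
  | 0 => (fun r => - f1 r, fun=> 0)
  | 1 => (fun r => - f1 r / f r ^+ 2, fun=> 0)
  | 2 => (fun r => 2 * r, fun=> 0)
  | _ => (fun r => 2 * r, fun th => 2 * sin th * cos th)
  end.

Definition static_metric x : 'M[R]_4 :=
  diag_mx (\row_(i < 4) sep (static_coef i).1 (static_coef i).2 x).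

Definition static_gamma (a b c : nat) : (R -> R) * (R -> R) :=
  match a, b, c with
  | 0, 0, 1 | 0, 1, 0 => (fun r => f1 r / (2 * f r), fun=> 1)
  | 1, 0, 0 => (fun r => f r * f1 r / 2, fun=> 1)
  | 1, 1, 1 => (fun r => - (f1 r / (2 * f r)), fun=> 1)
  | 1, 2, 2 => (fun r => - (r * f r), fun=> 1)
  | 1, 3, 3 => (fun r => - (r * f r), fun th => sin th ^+ 2)
  | 2, 1, 2 | 2, 2, 1 | 3, 1, 3 | 3, 3, 1 => (fun r => r^-1, fun=> 1)
  | 2, 3, 3 => (fun=> - 1, fun th => sin th * cos th)
  | 3, 2, 3 | 3, 3, 2 => (fun=> 1, fun th => cos th / sin th)
  | _, _, _ => (fun=> 0, fun=> 0)
  end.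

(** The derivative of cot is kept as -(sin^2 + cos^2) / sin^2, so that the later curvature
    identities are rational in sin and cos and [field] proves them without the Pythagorean
    relation. *)
Definition static_dgamma (a b c : nat) : (R -> R) * (R -> R) :=
  match a, b, c with
  | 0, 0, 1 | 0, 1, 0 =>
      (fun r => (f2 r * f r - f1 r ^+ 2) / (2 * f r ^+ 2), fun=> 0)
  | 1, 0, 0 => (fun r => (f1 r ^+ 2 + f r * f2 r) / 2, fun=> 0)
  | 1, 1, 1 =>
      (fun r => - ((f2 r * f r - f1 r ^+ 2) / (2 * f r ^+ 2)), fun=> 0)
  | 1, 2, 2 => (fun r => - (f r + r * f1 r), fun=> 0)
  | 1, 3, 3 =>
      (fun r => - (f r + r * f1 r), fun th => 2 * sin th * cos th)
  | 2, 1, 2 | 2, 2, 1 | 3, 1, 3 | 3, 3, 1 => (fun r => - r ^- 2, fun=> 0)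
  | 2, 3, 3 => (fun=> 0, fun th => cos th ^+ 2 - sin th ^+ 2)
  | 3, 2, 3 | 3, 3, 2 =>
      (fun=> 0, fun th => - (sin th ^+ 2 + cos th ^+ 2) / sin th ^+ 2)
  | _, _, _ => (fun=> 0, fun=> 0)
  end.

(** * Derivatives of the radial and angular factors *)

Lemma is_derive_sin_sqr th :
  is_derive th 1 (fun t : R => sin t ^+ 2) (2 * sin th * cos th).
Proof.
apply: (is_derive_eq (is_deriveM (is_derive_sin th) (is_derive_sin th))).
by rewrite -[_ *: _]/(_ * _); ring.
Qed.

Lemma is_derive_sqr r : is_derive r 1 (fun t : R => t ^+ 2) (2 * r).
Proof.
apply: (is_derive_eq (is_deriveM (is_derive_id r 1) (is_derive_id r 1))).
by rewrite -[_ *: _]/(_ * _) /=; ring.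
Qed.

Lemma is_derive_mul (F G : R -> R) r dF dG :
  is_derive r 1 F dF -> is_derive r 1 G dG ->
  is_derive r 1 (fun t => F t * G t) (dF * G r + F r * dG).
Proof.
move=> dFr dGr; apply: (is_derive_eq (is_deriveM dFr dGr)).
by rewrite -[_ *: _]/(_ * _) -[G r *: _]/(_ * _); ring.
Qed.

Lemma is_derive_inv (F : R -> R) r dF : F r != 0 ->
  is_derive r 1 F dF -> is_derive r 1 (fun t => (F t)^-1) (- dF / F r ^+ 2).
Proof.
move=> F0 dFr; apply: (is_derive_eq (is_deriveV F0 dFr)).
by rewrite -[_ *: _]/(_ * _); field.
Qed.

Section AtRadius.
Variables (r th : R).
Hypotheses (f0 : f r != 0) (df : is_derive r 1 f (f1 r)).

Lemma static_dcoefP i :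
  is_derive r 1 (static_coef i).1 ((static_dcoef i).1 r) /\
  is_derive th 1 (static_coef i).2 ((static_dcoef i).2 th).
Proof.
have := (is_derive_sqr r, is_derive_sin_sqr th, is_derive_cst (1 : R) th 1,
  is_deriveN df, is_derive_inv f0 df).
by case=> [[[[? ?] ?] ?] ?]; case: i => [|[|[|i]]].
Qed.

Hypotheses (df1 : is_derive r 1 f1 (f2 r)) (r0 : r != 0) (s0 : sin th != 0).

Lemma static_dgammaP a b c :
  is_derive r 1 (static_gamma a b c).1 ((static_dgamma a b c).1 r) /\
  is_derive th 1 (static_gamma a b c).2 ((static_dgamma a b c).2 th).
Proof.
have dcst (k t : R) : is_derive t 1 (fun=> k) 0 by exact: is_derive_cst.
have [d0 d1 dN1] := And3 (dcst 0) (dcst 1) (dcst (- 1)).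
have dr := is_derive_id r (1 : R).
have ds := is_derive_sin th; have dc := is_derive_cos th.
have ds2 := is_derive_sin_sqr th.
have g1 : is_derive r 1 (fun r => f1 r / (2 * f r))
    ((f2 r * f r - f1 r ^+ 2) / (2 * f r ^+ 2)).
  have F0 : 2 * f r != 0 by rewrite mulf_neq0 ?pnatr_eq0.
  apply: (is_derive_eq (is_derive_mul df1
    (is_derive_inv (F := fun t => 2 * f t) F0
      (is_derive_mul (dcst 2 r) df)))).
  by field; rewrite f0.
have g2 : is_derive r 1 (fun r => f r * f1 r / 2)
    ((f1 r ^+ 2 + f r * f2 r) / 2).
  apply: (is_derive_eq (is_derive_mul (is_derive_mul df df1)
    (dcst 2^-1 r))).
  by ring.
have g3 : is_derive r 1 (fun r => - (r * f r)) (- (f r + r * f1 r)).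
  by apply: (is_derive_eq (is_deriveN (is_derive_mul dr df))); ring.
have g4 : is_derive r 1 (fun r => r^-1) (- r ^- 2).
  by apply: (is_derive_eq (is_derive_inv (F := id) r0 dr)); field.
have g5 : is_derive th 1 (fun th => sin th * cos th)
    (cos th ^+ 2 - sin th ^+ 2).
  by apply: (is_derive_eq (is_derive_mul ds dc)); ring.
have g6 : is_derive th 1 (fun th => cos th / sin th)
    (- (sin th ^+ 2 + cos th ^+ 2) / sin th ^+ 2).
  by apply: (is_derive_eq (is_derive_mul dc (is_derive_inv s0 ds))); field.
have g1N := is_deriveN g1.
by case: a => [|[|[|[|a]]]]; case: b => [|[|[|[|b]]]];
  case: c => [|[|[|[|c]]]]; split.
Qed.

End AtRadius.

(** * Connection and curvature of the static metric on an open set *)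

Variable U : set 'rV[R]_4.
Hypotheses (openU : open U)
  (f0 : forall x, U x -> f (x 0 1) != 0)
  (r0 : forall x, U x -> x 0 1 != 0)
  (s0 : forall x, U x -> sin (x 0 2) != 0)
  (df : forall x, U x -> is_derive (x 0 1) 1 f (f1 (x 0 1)))
  (df1 : forall x, U x -> is_derive (x 0 1) 1 f1 (f2 (x 0 1))).

Lemma static_coef_neq0 x (i : nat) : U x ->
  sep (static_coef i).1 (static_coef i).2 x != 0.
Proof.
move=> Ux; have [? ? ?] := And3 (f0 Ux) (r0 Ux) (s0 Ux).
by case: i => [|[|[|i]]]; rewrite /sep /=;
  rewrite mulf_neq0 ?oppr_eq0 ?invr_eq0 ?expf_neq0 ?oner_eq0.
Qed.

Lemma static_christoffel x (a b c : 'I_4) : U x ->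
  christoffel static_metric a b c x =
    sep (static_gamma a b c).1 (static_gamma a b c).2 x.
Proof.
move=> Ux; rewrite christoffel_diag_mx => [|i]; last exact: static_coef_neq0.
have [dr_ dth_] := all_and2 (static_dcoefP (x 0 2) (f0 Ux) (df Ux)).
rewrite !(partial_sep _ (dr_ _) (dth_ _)).
have [? ? ?] := And3 (f0 Ux) (r0 Ux) (s0 Ux).
case: a => [[|[|[|[|?]]]] //= ?]; case: b => [[|[|[|[|?]]]] //= ?];
  case: c => [[|[|[|[|?]]]] //= ?]; rewrite /sep /=;
  field; rewrite ?f0 ?r0 ?s0 //.
Qed.

(** The closed form of the symbols is known only on [U]; openness of [U] allows it to be
    differentiated. *)
Lemma static_partial_christoffel x (a b c i : 'I_4) : U x ->
  partial i (christoffel static_metric a b c) x =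
    (i == 1)%:R * (static_dgamma a b c).1 (x 0 1)
                * (static_gamma a b c).2 (x 0 2)
    + (i == 2)%:R * (static_gamma a b c).1 (x 0 1)
                  * (static_dgamma a b c).2 (x 0 2).
Proof.
move=> Ux; rewrite (eq_on_partial openU i
  (fun y Uy => @static_christoffel y a b c Uy) Ux).
have [? ?] := static_dgammaP (f0 Ux) (df Ux) (df1 Ux) (r0 Ux) (s0 Ux) a b c.
exact: partial_sep.
Qed.

(** Indices appear as explicit ordinals, so that the matches in [static_gamma] and [static_dgamma]
    compute. *)
Lemma sum_ord4 (F : 'I_4 -> R) : \sum_i F i =
  F (@Ordinal 4 0 isT) + F (@Ordinal 4 1 isT) + F (@Ordinal 4 2 isT)
  + F (@Ordinal 4 3 isT).
Proof.
by rewrite !big_ord_recr big_ord0 /= add0r; do !congr (_ + _);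
  congr F; apply: val_inj.
Qed.

Lemma static_metric_unit x : U x -> static_metric x \in unitmx.
Proof.
by move=> Ux; apply: diag_mx_unit => i; rewrite mxE static_coef_neq0.
Qed.

Definition static_ricci x : 'M[R]_4 :=
  let r := x 0 1 in
  let a := f2 r / 2 + f1 r / r in
  let c := f r + r * f1 r - 1 in
  diag_mx (\row_i [:: - (f r * a); a / f r; c; sin (x 0 2) ^+ 2 * c]`_i).

Lemma ricci_static_metric x : U x -> ricci static_metric x = static_ricci x.
Proof.
move=> Ux; apply/matrixP => q u; rewrite ricciE; first last.
- by rewrite /static_metric tr_diag_mx.
- exact: static_metric_unit.
under eq_bigr => p _ do
  (rewrite !static_partial_christoffel //;
   under eq_bigr => e _ do rewrite !static_christoffel //;
   under [X in _ - X]eq_bigr => e _ do rewrite !static_christoffel //).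
have [? ? ?] := And3 (f0 Ux) (r0 Ux) (s0 Ux).
rewrite !sum_ord4 /sep /static_ricci !mxE.
case: q => [[|[|[|[|?]]]] //= ?]; case: u => [[|[|[|[|?]]]] //= ?].
all: by rewrite ?mulr0n ?mulr1n; field; rewrite ?f0 ?r0 ?s0.
Qed.

(** With a and c as in [static_ricci], the t and r directions each contribute a to the trace, and
    the two angles c / r^2 each. *)
Lemma scalar_curvature_static_metric x : U x ->
  scalar_curvature static_metric x =
    f2 (x 0 1) + 4 * f1 (x 0 1) / x 0 1 + 2 * (f (x 0 1) - 1) / x 0 1 ^+ 2.
Proof.
move=> Ux; rewrite /scalar_curvature ricci_static_metric // /metric_inv.
rewrite invmx_diag => [|i]; last by rewrite mxE static_coef_neq0.
have [? ? ?] := And3 (f0 Ux) (r0 Ux) (s0 Ux).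
rewrite !sum_ord4 /static_ricci !mxE /sep /= ?mulr0n ?mulr1n.
by field; rewrite ?f0 ?r0 ?s0.
Qed.

Lemma lie_derivative_static_metric x : U x ->
  lie_derivative d_dr static_metric x =
    diag_mx (\row_i ((static_dcoef i).1 (x 0 1) * (static_coef i).2 (x 0 2))).
Proof.
move=> Ux; rewrite /d_dr lie_derivative_coord; apply/matrixP => i j.
have [dr_ dth_] := all_and2 (static_dcoefP (x 0 2) (f0 Ux) (df Ux)).
rewrite !mxE partial_diag_mx (partial_sep _ (dr_ i) (dth_ i)) eqxx mul1r.
by rewrite (_ : (1 == 2) = false) // !mul0r addr0 mulr_natl.
Qed.

End StaticSphericallySymmetric.

(** * The Hayward metric *)

Section HaywardGeometry.
Context {R : realType} (m b : R).
Hypotheses (m_gt0 : 0 < m) (b_gt0 : 0 < b).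
Local Notation U := (hayward_domain m b).
Implicit Types (x : 'rV[R]_4) (r : R).

Definition hayward_f r : R := hayB m b r / hayB1 m b r.

(** The derivative f': the quotient-rule numerator B' B_1 - B B_1' collapses to -2 m r B_2. *)
Definition hayward_f1 r : R := - (2 * m * r * hayB2 m b r / hayB1 m b r ^+ 2).

(** The second derivative f'', using (r B_2)' = 4 (b^2 m - r^3). *)
Definition hayward_f2 r : R :=
  (12 * m * r ^+ 3 * hayB2 m b r
   - 8 * m * (b ^+ 2 * m - r ^+ 3) * hayB1 m b r) / hayB1 m b r ^+ 3.

(** An equality of functions on the whole coordinate space, since with 0^-1 = 0 the inverse of B /
    B_1 is always B_1 / B. It can therefore be rewritten under derivatives. *)
Lemma hayward_metricE : hayward_metric m b = static_metric hayward_f.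
Proof.
apply/funext => x; congr diag_mx; apply/rowP => i; rewrite !mxE /sep.
by case: i => [[|[|[|[|?]]]] //= ?]; rewrite ?mulr1 // invf_div.
Qed.

Lemma hayB1_gt0 r : 0 < r -> 0 < hayB1 m b r.
Proof. by move=> r0; rewrite /hayB1 addr_gt0 ?mulr_gt0 ?exprn_gt0. Qed.

(** The polynomial in the definition of the domain is B expanded, sin is positive on (0, pi), and
    B_1 is positive for r > 0. *)
Lemma hayward_domainP x : U x ->
  [/\ x 0 1 != 0, sin (x 0 2) != 0, hayB m b (x 0 1) != 0
    & hayB1 m b (x 0 1) != 0].
Proof.
case=> r0 t0 tpi B0; split.
- by rewrite gt_eqF.
- by rewrite gt_eqF // sin_gt0_pi // t0.
- by apply: contra_neq B0 => B0; rewrite -B0 /hayB; ring.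
- by rewrite gt_eqF // hayB1_gt0.
Qed.

(** * Derivatives of B, B_1, B_2 and f *)

Lemma is_derive_hayB r :
  is_derive r 1 (hayB m b) (3 * r ^+ 2 - 4 * m * r).
Proof.
have dr := is_derive_id r (1 : R).
have d := is_deriveD (is_derive_cst (2 * b ^+ 2 * m) r 1)
  (is_derive_mul (is_derive_sqr r)
    (is_deriveD dr (is_derive_cst (- (2 * m)) r 1))).
by apply: (is_derive_eq d); rewrite !fctE; ring.
Qed.

Lemma is_derive_cube r : is_derive r 1 (fun t : R => t ^+ 3) (3 * r ^+ 2).
Proof.
have d := is_derive_mul (is_derive_id r (1 : R)) (is_derive_sqr r).
by apply: (is_derive_eq d) => /=; ring.
Qed.

Lemma is_derive_hayB1 r : is_derive r 1 (hayB1 m b) (3 * r ^+ 2).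
Proof.
have d := is_deriveD (is_derive_cst (2 * b ^+ 2 * m) r 1) (is_derive_cube r).
by apply: (is_derive_eq d) => /=; ring.
Qed.

Lemma is_derive_hayB2 r : is_derive r 1 (hayB2 m b) (- (3 * r ^+ 2)).
Proof.
have d := is_deriveD (is_derive_cst (4 * b ^+ 2 * m) r 1)
  (is_deriveN (is_derive_cube r)).
by apply: (is_derive_eq d) => /=; ring.
Qed.

Lemma is_derive_hayward_f r : hayB1 m b r != 0 ->
  is_derive r 1 hayward_f (hayward_f1 r).
Proof.
move=> B10.
have d := is_derive_mul (is_derive_hayB r)
  (is_derive_inv B10 (is_derive_hayB1 r)).
apply: (is_derive_eq d); rewrite /hayward_f1 /hayB2.
by move: B10; rewrite /hayB /hayB1 => B10; field.
Qed.

Lemma is_derive_hayward_f1 r : hayB1 m b r != 0 ->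
  is_derive r 1 hayward_f1 (hayward_f2 r).
Proof.
move=> B10.
have B120 : hayB1 m b r ^+ 2 != 0 by rewrite expf_neq0.
have dB12 := is_derive_mul (is_derive_hayB1 r) (is_derive_hayB1 r).
have d := is_deriveN (is_derive_mul (is_derive_mul (is_derive_mul
    (is_derive_cst (2 * m) r 1) (is_derive_id r 1)) (is_derive_hayB2 r))
  (is_derive_inv (F := fun t => hayB1 m b t ^+ 2) B120 dB12)).
apply: (is_derive_eq d); rewrite !fctE /hayward_f2 /hayB2.
by move: B10; rewrite /hayB1 => B10; field.
Qed.

Lemma open_hayward_domain : open U.
Proof.
have openC (A : set R) (j : 'I_4) : open A ->
    open [set x : 'rV[R]_4 | A (x 0 j)].
  by move=> oA; apply: open_comp oA => x _; exact: coord_continuous.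
(* The domain is an intersection of preimages of open sets of reals under coordinates; for the last
   one, B is continuous because it is derivable. *)
rewrite (_ : U = [set x | 0 < x 0 1] `&` [set x | 0 < x 0 2]
  `&` [set x | x 0 2 < pi] `&` [set x | hayB m b (x 0 1) != 0]).
  do !apply: openI.
  - exact: openC (@open_gt _ _).
  - exact: openC (@open_gt _ _).
  - exact: openC (@open_lt _ _).
  apply: (openC [set r | hayB m b r != 0]).
  apply: (@open_comp _ _ (hayB m b) [set y | y != 0]); last exact: open_neq.
  move=> r _; apply/differentiable_continuous/derivable1_diffP.
  by case: (is_derive_hayB r).
apply/seteqP; split=> x /=.
  by move=> [? ? ? B0]; have [] := hayward_domainP (And4 _ _ _ B0).
move=> [[[? ?] ?] B0]; split=> //; apply: contra_neq B0 => B0.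
by rewrite -B0 /hayB; ring.
Qed.

(** * The static formulas specialised to f = B / B_1 *)

Let f0 x : U x -> hayward_f (x 0 1) != 0.
Proof.
by case/hayward_domainP => _ _ B0 B10; rewrite mulf_neq0 ?invr_eq0.
Qed.

Let r0 x : U x -> x 0 1 != 0. Proof. by case/hayward_domainP. Qed.

Let s0 x : U x -> sin (x 0 2) != 0. Proof. by case/hayward_domainP. Qed.

Let df x : U x -> is_derive (x 0 1) 1 hayward_f (hayward_f1 (x 0 1)).
Proof. by case/hayward_domainP => *; apply: is_derive_hayward_f. Qed.

Let df1 x : U x -> is_derive (x 0 1) 1 hayward_f1 (hayward_f2 (x 0 1)).
Proof. by case/hayward_domainP => *; apply: is_derive_hayward_f1. Qed.

(** Since f - 1 = -2 m r^2 / B_1 and f' has a factor r, all powers of 1/r cancel. *)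
Lemma hayward_kappaE x : U x ->
  hayward_kappa m b x =
    24 * b ^+ 2 * m ^+ 2 * (x 0 1 ^+ 3 - 4 * b ^+ 2 * m)
    / hayB1 m b (x 0 1) ^+ 3.
Proof.
move=> Ux; rewrite /hayward_kappa hayward_metricE.
rewrite (scalar_curvature_static_metric open_hayward_domain f0 r0 s0 df df1) //.
have [rx0 _ _ B10] := hayward_domainP Ux.
rewrite /hayward_f /hayward_f1 /hayward_f2 /hayB2.
by move: B10; rewrite /hayB /hayB1 => B10; field; rewrite ?rx0 ?B10.
Qed.

(** Follows the structure of an expression and leaves only the nonvanishing of its denominators. *)
Ltac prove_smooth oU :=
  repeat first [ exact: (smooth_cst oU) | exact: (smooth_coord oU)
    | exact: (smooth_sin_coord oU) | apply: (smoothN oU) | apply: (smoothD oU)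
    | apply: (smoothM oU) | apply: (smoothX oU) | apply: (smoothV oU) ].

Lemma smooth_sigma1 : smooth U (sigma1 m b).
Proof.
rewrite /sigma1 /= /hayB /hayB1; prove_smooth open_hayward_domain => x Ux.
have [rx0 _ B0 _] := hayward_domainP Ux.
by do !apply: mulf_neq0 => //;
  rewrite ?expf_neq0 ?pnatr_eq0 ?(gt_eqF m_gt0) ?(gt_eqF b_gt0).
Qed.

Lemma smooth_sigma2 : smooth U (sigma2 m b).
Proof.
rewrite /sigma2 /= /hayB; prove_smooth open_hayward_domain => x Ux.
have [rx0 _ B0 _] := hayward_domainP Ux.
by do !apply: mulf_neq0 => //; rewrite ?expf_neq0 ?pnatr_eq0.
Qed.

Lemma smooth_sigma3 : smooth U (sigma3 m b).
Proof.
rewrite /sigma3 /= /hayB /hayB2; prove_smooth open_hayward_domain => x Ux.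
by have [_ _ B0 _] := hayward_domainP Ux; rewrite expf_neq0.
Qed.

Lemma smooth_hayward_kappa : smooth U (hayward_kappa m b).
Proof.
have oU := open_hayward_domain.
apply: (eq_on_smooth oU (fun x Ux => esym (hayward_kappaE Ux))).
rewrite /hayB1; prove_smooth oU => x Ux.
by have [_ _ _ B10] := hayward_domainP Ux; rewrite expf_neq0.
Qed.

Lemma pseudo_riemannian_hayward : pseudo_riemannian U (hayward_metric m b).
Proof.
have oU := open_hayward_domain; rewrite hayward_metricE; split=> //.
- move=> i j.
  apply: (@eq_on_smooth _ _ _ oU (fun x => (i == j)%:R
    * sep (static_coef hayward_f i).1 (static_coef hayward_f i).2 x)).
    by move=> x _; rewrite !mxE mulr_natl.
  apply: (smoothM oU); first exact: smooth_cst.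
  (* The coefficients are built from f, 1/f, r^2 and sin^2 theta, so f is the only new
     ingredient. *)
  have sf : smooth U (fun x => hayward_f (x 0 1)).
    rewrite /hayward_f /hayB /hayB1; prove_smooth oU => x Ux.
    by have [] := hayward_domainP Ux.
  by case: i => [[|[|[|[|?]]]] //= ?]; rewrite /sep /=; apply: (smoothM oU);
    do ?[exact: (smoothN oU)|exact: (smoothV oU)]; prove_smooth oU.
- by move=> x Ux; rewrite tr_diag_mx.
- exact: static_metric_unit f0 r0 s0.
Qed.

(** With a and c as in [static_ricci], the tt and theta-theta entries read sigma_1 a + sigma_2 = -f'
    / (2 f) and sigma_1 c + sigma_2 r^2 = -r, a linear system solved by sigma_1 and sigma_2. The rr
    entry then amounts to sigma_3 = -f' / f^2, and the phi-phi entry is sin^2 theta times the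
    theta-theta one. *)
Lemma hayward_soliton_eq x : U x ->
  2^-1 *: lie_derivative d_dr (hayward_metric m b) x
  + sigma1 m b x *: ricci (hayward_metric m b) x
  + (soliton_lambda m b x - 2^-1 * sigma4 x * hayward_kappa m b x)
      *: hayward_metric m b x
  - sigma3 m b x *: tensor_square dr x = 0.
Proof.
move=> Ux; rewrite /soliton_lambda /sigma4 mulVf ?pnatr_eq0 // mul1r addrK.
rewrite hayward_metricE (lie_derivative_static_metric f0 df) //.
rewrite (ricci_static_metric open_hayward_domain f0 r0 s0 df df1) //.
apply/matrixP => i j; rewrite !mxE big_ord1 !mxE /sep eqxx /=.
have [rx0 sx0 B0 B10] := hayward_domainP Ux.
have [m0 bn0] : m != 0 /\ b != 0 by rewrite !gt_eqF.
have [-> | ij] := eqVneq i j; last first.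
  (* Off the diagonal only the square of eta remains, and its single nonzero entry is the diagonal
     entry rr. *)
  rewrite !mulr0n !mulr0 !addr0 add0r.
  have [i1|] := eqVneq i 1; last by rewrite mul0r mulr0 oppr0.
  by rewrite -i1 eq_sym (negbTE ij) !mulr0 oppr0.
rewrite !mulr1n; move: B0 B10.
rewrite /sigma1 /sigma2 /sigma3 /hayward_f /hayward_f1 /hayward_f2.
rewrite /hayB /hayB1 /hayB2 => B0 B10.
case: j => [[|[|[|[|?]]]] //= ?].
all: rewrite /hayward_f /hayward_f1 /hayB /hayB1 /hayB2.
all: by field; rewrite ?rx0 ?B0 ?B10 ?m0 ?bn0.
Qed.

Lemma hayward_domain_nonempty : exists x, U x.
Proof.
(* At r = 2 m the term r^2 (r - 2 m) vanishes, leaving B = 2 b^2 m > 0. *)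
exists (\row_i [:: 0; 2 * m; pi / 2; 0]`_i); rewrite /hayward_domain /= !mxE /=.
have := pi_gt0 R => pi0; split; rewrite ?mulr_gt0 //; try lra.
rewrite (_ : _ + _ = 2 * b ^+ 2 * m); last by ring.
by rewrite gt_eqF // !mulr_gt0 ?exprn_gt0.
Qed.

Lemma d_dr_not_killing : ~ killing U (hayward_metric m b) d_dr.
Proof.
(* The theta-theta entry of the Lie derivative is (r^2)' = 2 r, which is nonzero. *)
have [x Ux] := hayward_domain_nonempty => /(_ x Ux) /matrixP /(_ 2 2).
rewrite hayward_metricE (lie_derivative_static_metric f0 df) // !mxE /=.
by move/eqP; rewrite mulr1 mulf_eq0 pnatr_eq0 (negbTE (r0 Ux)).
Qed.

End HaywardGeometry.

Theorem theorem6p1 (R : realType) (m b : R) (m_gt0 : 0 < m) (b_gt0 : 0 < b) :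
  [/\ almost_eta_ricci_yamabe_soliton (hayward_domain m b)
        (hayward_metric m b) d_dr dr
        (sigma1 m b) sigma4 (soliton_lambda m b) (fun x => - sigma3 m b x),
      ~ killing (hayward_domain m b) (hayward_metric m b) d_dr
    & forall x, hayward_domain m b x ->
        2^-1 *: lie_derivative d_dr (hayward_metric m b) x
        + sigma1 m b x *: ricci (hayward_metric m b) x
        + (soliton_lambda m b x - 2^-1 * sigma4 x * hayward_kappa m b x)
            *: hayward_metric m b x
        - sigma3 m b x *: tensor_square dr x = 0].
Proof.
split; [|exact: d_dr_not_killing|exact: hayward_soliton_eq].
have oU := open_hayward_domain m_gt0 b_gt0; split.
- exact: pseudo_riemannian_hayward.
- by move=> i; apply: smooth_cst.
- by move=> i; apply: smooth_cst.
- have [x Ux] := hayward_domain_nonempty m_gt0 b_gt0; exists x => //.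
  by apply/eqP => /matrixP /(_ 0 1); rewrite !mxE => /eqP; rewrite oner_eq0.
- exact: smooth_sigma1.
- exact: smooth_cst.
- by apply: smoothD => //; [exact: smooth_sigma2|exact: smooth_hayward_kappa].
- by apply: smoothN => //; exact: smooth_sigma3.
- by move=> x Ux; rewrite scaleNr; exact: hayward_soliton_eq.
Qed.
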